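(* $n(6,11) \leq 7783$; that is, there exists a $6$-regular graph of girth exactly $11$ with at most $7783$ vertices.
   Context: Graphs are finite and simple. For integers $k\ge 2$, $g\ge 3$, a $(k,g)$-graph is a $k$-regular graph with girth $g$ (the length of a shortest cycle is exactly $g$). $n(k,g)$ denotes the smallest possible number of vertices of a $(k,g)$-graph. *)

(* Defs.v *)
From mathcomp Require Import all_boot.

Set Implicit Arguments.
Unset Strict Implicit.
Unset Printing Implicit Defensive.

Record sgraph := SGraph {
  vertex :> finType;
  adj : rel vertex;
  adj_sym : symmetric adj;
  adj_irrefl : irreflexive adj
}.

Definition graph_order (G : sgraph) : nat := #|G|.

Definition regular (k : nat) (G : sgraph) : Prop :=
  forall x : G, #|[set y | adj x y]| = k.

(* The vertices are listed without repetition and the closing edge joins the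
   last one to the first.  [ucycle] also accepts [::] and [:: x; y] for an edge xy,
   which are not cycles of a simple graph. *)
Definition is_cycle (G : sgraph) (c : seq G) : Prop :=
  ucycle (@adj G) c /\ 2 < size c.

Definition has_girth (G : sgraph) (g : nat) : Prop :=
  (exists2 c : seq G, is_cycle c & size c = g) /\
  (forall c : seq G, is_cycle c -> g <= size c).

Definition kg_graph (k g : nat) (G : sgraph) : Prop :=
  regular k G /\ has_girth G g.

(* [is_n k g m] means "n(k,g) = m".  It is a relation rather than a function:
   a total function would need a default value when no (k,g)-graph exists,
   and an upper bound on it could then hold vacuously. *)
Definition is_n (k g m : nat) : Prop :=
  (exists2 G : sgraph, kg_graph k g G & graph_order G = m) /\
  (forall G : sgraph, kg_graph k g G -> m <= graph_order G).

(* Main.v *)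
(**
The graph is obtained by excision from the incidence graph of the split Cayley
generalized hexagon H(5), which is 6-regular of girth 12 on 7812 vertices.
Take two opposite points p and p'; they are joined by six geodesics ("legs") of
length 6.  Remove p, p', the interior vertices of three legs, and the interior
vertices other than the midpoint of the other three legs: 2 + 15 + 12 = 29
vertices.  The degrees are restored by joining neighbours of a common removed
vertex.  Such an edge replaces a path of length 2 of the hexagon, so a cycle
through one new edge has length at least 11.  The danger is an ordinary hexagon
(12-cycle) two of whose corners, at removed vertices, have been cut off.  Two such
vertices are at distance 6 on distinct legs, and the matchings are chosen so that
they disagree under the projection between the two.

No cycle of length at most 10 passes through a vertex whose non-backtracking
walks of length at most 5 all end at distinct vertices.  In the new graph this is
evaluated at one end of each of the 57 new edges.  All other cycles lie in H(5),
where six unipotent automorphisms move every vertex to one of 12 representatives.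
*)

From HB Require Import structures.
From Stdlib Require Import Classical.
Require Import Defs.
From mathcomp Require Import all_boot.
From mathcomp Require Import zify.

Set Implicit Arguments.
Unset Strict Implicit.
Unset Printing Implicit Defensive.

Lemma uniq_map_inj (S U : eqType) (f : S -> U) (s : seq S) :
  uniq (map f s) -> {in s &, injective f}.
Proof.
elim: s => //= z s IHs /andP [zs us] x y; rewrite !inE.
case/predU1P=> [->|xs] /predU1P [->|ys] // fxy; last exact: IHs.
  by rewrite fxy map_f in zs.
by rewrite -fxy map_f in zs.
Qed.

(** * Balls and the length of cycles *)

Section Balls.

Variables (T : eqType) (nb : T -> seq T).

(* A pair (u, v) stands for a non-backtracking walk ending with the edge uv; the
   empty walk at r is (r, r). *)
Definition step (l : seq (T * T)) : seq (T * T) :=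
  flatten [seq [seq (p.2, w) | w <- nb p.2 & w != p.1] | p <- l].

Definition ball (n : nat) (r : T) : seq (T * T) :=
  flatten (traject step [:: (r, r)] n.+1).

Let e : rel T := fun v w => w \in nb v.

Lemma mem_step l u v w : (u, v) \in l -> w \in nb v -> w != u -> (v, w) \in step l.
Proof.
move=> luv vw wu; apply/flatten_mapP; exists (u, v) => //=.
by apply: map_f; rewrite mem_filter wu.
Qed.

Lemma path_in_step r s x : path e r (rcons s x) -> uniq (r :: rcons s x) ->
  (last r s, x) \in iter (size s).+1 step [:: (r, r)].
Proof.
elim/last_ind: s x => [|s y IHs] x.
  rewrite /= andbT => rx /andP [].
  rewrite inE => neq _; apply: (@mem_step _ r) => //; first exact: mem_head.
  by rewrite eq_sym.
rewrite -rcons_cons rcons_path rcons_uniq last_rcons => /andP [ps yx] /andP [xs us].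
rewrite size_rcons iterS; apply: mem_step (IHs y ps us) yx _.
apply: contraNneq xs => ->; rewrite -rcons_cons mem_rcons.
by rewrite inE mem_last orbT.
Qed.

Lemma iter_step_ball n i r p :
  i <= n -> p \in iter i step [:: (r, r)] -> p \in ball n r.
Proof.
move=> le_in pi; apply/flattenP; exists (iter i step [:: (r, r)]) => //.
by apply/trajectP; exists i.
Qed.

(* Walking along the cycle from [r] in both directions until the walks meet
   reaches the meeting vertex from two different predecessors. *)
Lemma ucycle_ball n r (c : seq T) :
  uniq (map snd (ball n r)) -> {in c &, symmetric e} -> ucycle e c -> r \in c ->
  2 < size c -> n.*2 < size c.
Proof.
move=> ub sym /andP [cc uc] /rot_to [i p def_c] gt2.
rewrite ltnNge; apply/negP => small.
have sz : size c = (size p).+1 by rewrite -(size_rot i) def_c.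
have memc x : x \in r :: p -> x \in c by rewrite -def_c mem_rot.
have cr : path e r (rcons p r) by move: cc; rewrite -(rot_cycle i) def_c.
have up : uniq (r :: p) by rewrite -def_c rot_uniq.
have cr' : path e r (rcons (rev p) r).
  rewrite -rev_cons -{1}(last_rcons r p r) -[r :: p](belast_rcons r p r) rev_path.
  rewrite -(@eq_in_path _ (mem (r :: p)) e) //.
    by move=> x y xp yp; rewrite sym ?memc.
  by apply/allP => x; rewrite inE mem_rcons inE orbA orbb.
(* The vertex of index [k] is opposite [r] on the cycle: both arcs to it have length at most [n]. *)
pose k := (size p)./2.
have lt_k : k < size p by rewrite /k; lia.
have def_p : p = take k p ++ nth r p k :: drop k.+1 p.
  by rewrite -drop_nth // cat_take_drop.
have size1 : size (take k p) = k by rewrite size_takel // ltnW.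
have size2 : size (drop k.+1 p) = size p - k.+1 by rewrite size_drop.
move: (take k p) (nth r p k) (drop k.+1 p) def_p size1 size2.
move=> p1 x p2 def_p size1 size2.
have in1 : (last r p1, x) \in ball n r.
  apply: (@iter_step_ball _ (size p1).+1); first by rewrite size1 /k; lia.
  apply: path_in_step.
    by move: cr; rewrite def_p -cat_rcons rcons_cat cat_path => /andP [].
  by move: up; rewrite def_p -cat_rcons -cat_cons cat_uniq => /andP [].
have in2 : (last r (rev p2), x) \in ball n r.
  apply: (@iter_step_ball _ (size (rev p2)).+1).
    by rewrite size_rev size2 /k; lia.
  apply: path_in_step.
    move: cr'; rewrite def_p rev_cat rev_cons rcons_cat cat_path.
    by case/andP.
  have : uniq (r :: rev p) by move: up; rewrite /= mem_rev rev_uniq.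
  by rewrite def_p rev_cat rev_cons -cat_cons cat_uniq => /andP [].
have [] : (last r p1, x) = (last r (rev p2), x) by exact: (uniq_map_inj ub).
move=> same; move: up; rewrite def_p.
case/lastP: p1 size1 same {in1 def_p} => [|p1 y] /=.
  case: p2 size2 {in2} => [|z p2] /= size2 size1 => [|->]; first by lia.
  by rewrite rev_cons last_rcons !inE eqxx !orbT.
rewrite last_rcons => _ ->; case: p2 {in2 size2} => [|z p2] /=.
  by rewrite mem_cat mem_rcons mem_head.
rewrite rev_cons last_rcons cat_uniq => /andP [_ /and3P [_ /hasPn /(_ z)]].
by rewrite !inE eqxx orbT mem_rcons mem_head => /(_ isT).
Qed.

End Balls.

(** * The generalized hexagon H(5) *)

(* The field with five elements as an enumerated type: unlike ['F_5], its
   operations are evaluated cheaply by the kernel. *)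
Inductive F5 := F0 | F1 | F2 | F3 | F4.

Definition F5_eqb (x y : F5) : bool :=
  match x, y with
  | F0, F0 | F1, F1 | F2, F2 | F3, F3 | F4, F4 => true
  | _, _ => false
  end.

Lemma F5_eqP : Equality.axiom F5_eqb.
Proof. by do 2!case; constructor. Qed.

HB.instance Definition _ := hasDecEq.Build F5 F5_eqP.

Definition nat_of_F5 (x : F5) : nat :=
  match x with F0 => 0 | F1 => 1 | F2 => 2 | F3 => 3 | F4 => 4 end.

Definition F5_of_nat (n : nat) : F5 := nth F0 [:: F0; F1; F2; F3; F4] n.

Lemma nat_of_F5K : cancel nat_of_F5 F5_of_nat.
Proof. by case. Qed.

HB.instance Definition _ := Choice.copy F5 (can_type nat_of_F5K).

Declare Scope F5_scope.
Delimit Scope F5_scope with F5.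
Bind Scope F5_scope with F5.

Definition F5_succ (x : F5) : F5 :=
  match x with F0 => F1 | F1 => F2 | F2 => F3 | F3 => F4 | F4 => F0 end.

Definition F5_double (x : F5) : F5 :=
  match x with F0 => F0 | F1 => F2 | F2 => F4 | F3 => F1 | F4 => F3 end.

Definition F5_opp (x : F5) : F5 :=
  match x with F0 => F0 | F1 => F4 | F2 => F3 | F3 => F2 | F4 => F1 end.

Definition F5_pred (x : F5) : F5 :=
  match x with F0 => F4 | F1 => F0 | F2 => F1 | F3 => F2 | F4 => F3 end.

Definition F5_add (x y : F5) : F5 :=
  match x with
  | F0 => y | F1 => F5_succ y | F2 => F5_succ (F5_succ y)
  | F3 => F5_pred (F5_pred y) | F4 => F5_pred y
  end.

Definition F5_mul (x y : F5) : F5 :=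
  match x with
  | F0 => F0 | F1 => y | F2 => F5_double y
  | F3 => F5_opp (F5_double y) | F4 => F5_opp y
  end.

Notation "x + y" := (F5_add x y) : F5_scope.
Notation "x - y" := (F5_add x (F5_opp y)) : F5_scope.
Notation "x * y" := (F5_mul x y) : F5_scope.

Definition F5_enum : seq F5 := [:: F0; F1; F2; F3; F4].

(* De Smet-Van Maldeghem coordinates.  The graph consists of two 5-ary trees of
   depth 5 whose roots, the line [oo] (in the tree [true]) and the point (oo) (in
   the tree [false]), are adjacent.  In the tree [true] the points are (a),
   (a,l,a'), (a,l,a',l',a'') and the lines are [oo], [a,l], [a,l,a',l']; in the
   tree [false] the lines are [k], [k,b,k'], [k,b,k',b',k''] and the points are
   (oo), (k,b), (k,b,k',b').  A point (a,l,a',l',a'') and a line [k,b,k',b',k'']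
   are incident when
     b   = a'' - a k,
     k'  = a^3 k^2 + l' - k l - 3 a^2 a'' k - 3 a' a'' + 3 a a''^2,
     b'  = a^2 k + a' - 2 a a'',
     k'' = a^3 k + l - 3 a^2 a'' + 3 a a'.
   The second branch of [child] solves these equations for the point. *)
Definition hvertex : Type := (bool * seq F5)%type.

Definition parent (v : hvertex) : hvertex :=
  if v.2 is x :: s then (v.1, belast x s) else (~~ v.1, [::]).

Definition child (v : hvertex) (x : F5) : hvertex :=
  match v with
  | (true, [:: a; l; a'; l'; a'']) =>
      let a2 := (a * a)%F5 in let a3 := (a * a2)%F5 in
      (false, [:: x; a'' - a * x;
        a3 * x * x + l' - x * l - F3 * a2 * a'' * x - F3 * a' * a''
          + F3 * a * a'' * a'';
        a2 * x + a' - F2 * a * a'';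
        a3 * x + l - F3 * a'' * a2 + F3 * a * a']%F5)
  | (false, [:: k; b; k'; b'; k'']) =>
      let x2 := (x * x)%F5 in let x3 := (x * x2)%F5 in
      let a'' := (b + x * k)%F5 in
      let a' := (b' - x2 * k + F2 * x * a'')%F5 in
      let l := (k'' - x3 * k + F3 * a'' * x2 - F3 * x * a')%F5 in
      (true, [:: x; l; a';
        k' - x3 * k * k + k * l + F3 * x2 * a'' * k + F3 * a' * a''
          - F3 * x * a'' * a''; a'']%F5)
  | (t, s) => (t, rcons s x)
  end.

Definition hnbrs (v : hvertex) : seq hvertex := parent v :: map (child v) F5_enum.

Definition words (n : nat) : seq (seq F5) :=
  iter n (fun ws => [seq x :: s | x <- F5_enum, s <- ws]) [:: [::]].

Definition hexagon : seq hvertex :=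
  [seq (t, s) | t <- [:: true; false], s <- flatten (map words (iota 0 6))].

(* Sets of vertices as 5-ary tries, so that testing the ball of a vertex for
   duplicates takes almost linear time. *)
Inductive trie (A : Type) := Leaf | Node (v : option A) (t0 t1 t2 t3 t4 : trie A).
Arguments Leaf {A}.

Fixpoint lookup (A : Type) (t : trie A) (k : seq F5) : option A :=
  if t is Node v t0 t1 t2 t3 t4 then
    match k with
    | [::] => v
    | F0 :: k' => lookup t0 k'
    | F1 :: k' => lookup t1 k'
    | F2 :: k' => lookup t2 k'
    | F3 :: k' => lookup t3 k'
    | F4 :: k' => lookup t4 k'
    end
  else None.

Fixpoint insert (A : Type) (a : A) (k : seq F5) (t : trie A) : trie A :=
  let: (v, t0, t1, t2, t3, t4) :=
    if t is Node v t0 t1 t2 t3 t4 then (v, t0, t1, t2, t3, t4)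
    else (None, Leaf, Leaf, Leaf, Leaf, Leaf) in
  match k with
  | [::] => Node (Some a) t0 t1 t2 t3 t4
  | F0 :: k' => Node v (insert a k' t0) t1 t2 t3 t4
  | F1 :: k' => Node v t0 (insert a k' t1) t2 t3 t4
  | F2 :: k' => Node v t0 t1 (insert a k' t2) t3 t4
  | F3 :: k' => Node v t0 t1 t2 (insert a k' t3) t4
  | F4 :: k' => Node v t0 t1 t2 t3 (insert a k' t4)
  end.

Definition key (v : hvertex) : seq F5 := (if v.1 then F0 else F1) :: v.2.

Fixpoint distinct (t : trie unit) (s : seq hvertex) : bool :=
  if s is v :: s' then
    if lookup t (key v) is Some _ then false else distinct (insert tt (key v) t) s'
  else true.

Arguments key : simpl never.
Arguments insert : simpl never.

Definition tree_ball (nb : hvertex -> seq hvertex) (r : hvertex) : bool :=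
  distinct Leaf (map snd (ball nb 5 r)).

Lemma lookup_insert (A : Type) (a : A) k t k' :
  lookup (insert a k t) k' = if k == k' then Some a else lookup t k'.
Proof.
elim: k t k' => [|x k IHk] t k'.
  by case: t => [|v t0 t1 t2 t3 t4]; case: k' => [|[] k'].
case: k' => [|y k']; first by case: t x => [|v t0 t1 t2 t3 t4] [].
rewrite eqseq_cons.
by case: t => [|v t0 t1 t2 t3 t4]; case: x; case: y => //=; rewrite IHk.
Qed.

Lemma distinct_uniq t s : distinct t s ->
  uniq s && all (fun v => ~~ isSome (lookup t (key v))) s.
Proof.
elim: s t => //= v s IHs t; case tv: (lookup _ _) => //= /IHs /andP [-> new].
rewrite andbT; apply/andP; split.
  by apply: contraTN new => vs; apply/allPn; exists v => //; rewrite lookup_insert eqxx.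
apply/allP => w /(allP new); rewrite lookup_insert; by case: eqP.
Qed.

(* Unipotent automorphisms, given on the sequences of length 5.  They act on shorter
   coordinate sequences through truncation, because no new coordinate depends on
   a later old one. *)
Definition action := bool -> seq F5 -> seq F5.

Definition act (f : action) (v : hvertex) : hvertex :=
  (v.1, take (size v.2) (f v.1 (take 5 (v.2 ++ nseq 5 F0)))).

Definition T_a : action :=
  fun t s => match t, s with
  | true, [:: a; l; a'; l'; a''] => [:: a + F1; l; a'; l'; a'']%F5
  | false, [:: k; b; k'; b'; k''] =>
     [:: k; b - k; k' + F3 * b * b - F3 * k * b + k * k; b' - F2 * b + k;
         k'' + F3 * b' - F3 * b + k]%F5
  | _, _ => s
  end.

Definition T_k : action :=
  fun t s => match t, s with
  | true, [:: a; l; a'; l'; a''] =>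
     [:: a; l - a * a * a; a' + a * a; l' + a * a * a + l + F3 * a * a'; a'' + a]%F5
  | false, [:: k; b; k'; b'; k''] => [:: k + F1; b; k'; b'; k'']%F5
  | _, _ => s
  end.

Definition T_a'' : action :=
  fun t s => match t, s with
  | true, [:: a; l; a'; l'; a''] =>
     [:: a; l - F3 * a * a; a' + F2 * a; l' + F3 * a' + F3 * a; a'' + F1]%F5
  | false, [:: k; b; k'; b'; k''] => [:: k; b + F1; k'; b'; k'']%F5
  | _, _ => s
  end.

Definition T_a' : action :=
  fun t s => match t, s with
  | true, [:: a; l; a'; l'; a''] => [:: a; l - F3 * a; a' + F1; l'; a'']%F5
  | false, [:: k; b; k'; b'; k''] => [:: k; b; k' - F3 * b; b' + F1; k'']%F5
  | _, _ => s
  end.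

Definition T_l : action :=
  fun t s => match t, s with
  | true, [:: a; l; a'; l'; a''] => [:: a; l + F1; a'; l'; a'']%F5
  | false, [:: k; b; k'; b'; k''] => [:: k; b; k' - k; b'; k'' + F1]%F5
  | _, _ => s
  end.

Definition T_l' : action :=
  fun t s => match t, s with
  | true, [:: a; l; a'; l'; a''] => [:: a; l; a'; l' + F1; a'']%F5
  | false, [:: k; b; k'; b'; k''] => [:: k; b; k' + F1; b'; k'']%F5
  | _, _ => s
  end.

Definition act_ok (f : action) (v : hvertex) : bool :=
  (iter 5 (act f) v == v) &&
  let n := hnbrs (act f v) in all (fun w => act f w \in n) (hnbrs v).

(* [clear (f, (i, j))] applies [f] until coordinate [i] (in the tree [true]) or [j]
   (in the tree [false]) vanishes.  A coordinate that does not exist counts as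
   zero; the index 5 says that there is nothing to clear. *)
Definition clear (m : action * (nat * nat)) (v : hvertex) : hvertex :=
  iter 4 (fun v =>
    if nth F0 v.2 (if v.1 then m.2.1 else m.2.2) == F0 then v else act m.1 v) v.

Definition moves : seq (action * (nat * nat)) :=
  [:: (T_a, (0, 5)); (T_k, (5, 0)); (T_a'', (4, 1)); (T_a', (2, 3));
      (T_l, (1, 4)); (T_l', (3, 2))].

Definition normalize (v : hvertex) : hvertex := foldl (fun v m => clear m v) v moves.

Definition roots : seq hvertex :=
  [seq (t, nseq n F0) | t <- [:: true; false], n <- iota 0 6].

Lemma mem_words n s : (s \in words n) = (size s == n).
Proof.
elim: n s => [|n IHn] s; first by rewrite inE; case: s.
have -> : words n.+1 = [seq x :: t | x <- F5_enum, t <- words n] by [].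
apply/allpairsP/idP => [[[x t] [_ + ->]]|]; first by rewrite IHn.
case: s => // x s sz; exists (x, s); split=> //; first by case: x {sz}.
by rewrite IHn.
Qed.

Lemma mem_hexagon v : (v \in hexagon) = (size v.2 <= 5).
Proof.
case: v => t s; apply/allpairsP/idP => [[[t' s'] [_ + [_ ->]]]|le_s5].
  by case/flatten_mapP=> n; rewrite mem_iota mem_words => lt_n6 /eqP ->.
exists (t, s); split=> //; first by case: t {le_s5}.
by apply/flatten_mapP; exists (size s); rewrite ?mem_words // mem_iota.
Qed.

(* Otherwise unification would evaluate the list of all vertices. *)
Opaque hexagon.

Lemma size_act f v : size (act f v).2 <= size v.2.
Proof. by rewrite size_take_min geq_minl. Qed.

Lemma hnbrs_sym_check : all (fun v => all (fun w => v \in hnbrs w) (hnbrs v)) hexagon.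
Proof. by vm_cast_no_check (erefl true). Qed.

Lemma hnbrs_sym : {in hexagon &, symmetric (fun v w => w \in hnbrs v)}.
Proof.
move=> v w hv hw; apply/idP/idP => vw.
  exact: (allP (allP hnbrs_sym_check v hv)).
exact: (allP (allP hnbrs_sym_check w hw)).
Qed.

Lemma moves_check : all (fun m => all (act_ok m.1) hexagon) moves.
Proof. by vm_cast_no_check (erefl true). Qed.

Lemma normalize_check : all (fun v => normalize v \in roots) hexagon.
Proof. by vm_cast_no_check (erefl true). Qed.

Lemma roots_check : all (tree_ball hnbrs) roots.
Proof. by vm_cast_no_check (erefl true). Qed.

Definition no_short_cycle (v : hvertex) : Prop :=
  forall c : seq hvertex, all (mem hexagon) c ->
  ucycle (fun v w => w \in hnbrs v) c -> v \in c -> 2 < size c -> 10 < size c.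

Lemma tree_ball_no_short_cycle r : tree_ball hnbrs r -> no_short_cycle r.
Proof.
move=> /distinct_uniq /andP [ub _] c hc ucc rc gt2.
apply: (ucycle_ball ub _ ucc rc gt2) => v w vc wc.
by apply: hnbrs_sym; apply: (allP hc).
Qed.

(** The fifth power of [act f] is the identity on [hexagon], so [act f] is injective there and
    carries cycles to cycles. *)
Lemma act_no_short_cycle f v : all (act_ok f) hexagon ->
  no_short_cycle (act f v) -> no_short_cycle v.
Proof.
move=> /allP ok nsc c hc /andP [cc uc] vc gt2.
rewrite -(size_map (act f)); apply: nsc; rewrite ?size_map ?map_f //.
  rewrite all_map; apply: sub_all hc => w /=; rewrite !mem_hexagon.
  exact: leq_trans (size_act f w).
apply/andP; split.
  apply: (homo_cycle_in _ hc cc) => x y hx _ /= xy.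
  by have /andP [_ /allP] := ok x hx; apply.
rewrite map_inj_in_uniq // => x y /(allP hc) hx /(allP hc) hy eq_xy.
have /andP [/eqP <- _] := ok x hx; have /andP [/eqP <- _] := ok y hy.
by rewrite !iterSr eq_xy.
Qed.

Lemma clear_no_short_cycle m v : all (act_ok m.1) hexagon ->
  no_short_cycle (clear m v) -> no_short_cycle v.
Proof.
move=> ok; rewrite /clear; elim: 4 v => // n IHn v; rewrite iterSr => /IHn.
by case: ifP => // _; apply: act_no_short_cycle.
Qed.

Lemma foldl_clear_no_short_cycle ms v :
  all (fun m => all (act_ok m.1) hexagon) ms ->
  no_short_cycle (foldl (fun v m => clear m v) v ms) -> no_short_cycle v.
Proof.
elim: ms v => // m ms IHms v /andP [okm okms] /(IHms _ okms).
exact: clear_no_short_cycle.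
Qed.

Lemma hexagon_no_short_cycle v : v \in hexagon -> no_short_cycle v.
Proof.
move=> /(allP normalize_check) /(allP roots_check) /tree_ball_no_short_cycle.
exact: foldl_clear_no_short_cycle moves_check.
Qed.

(** * Excision *)

(* The perfect matchings of {1,2,3,4}.  Matched indices are those of children of a
   removed vertex.  Projections between opposite vertices of different legs
   multiply the index by a unit of F_5 (by 1 at midpoints), which fixes [M0] and
   permutes [M1] and [M2]. *)
Definition M0 := [:: (F1, F4); (F2, F3)].
Definition M1 := [:: (F1, F2); (F3, F4)].
Definition M2 := [:: (F1, F3); (F2, F4)].
Definition zeros (t : bool) (x : seq F5) (n : nat) : hvertex := (t, x ++ nseq n F0).

(* The removed vertices of a leg, each with the edges inserted between its children.
   [m] is the matching at the midpoint, or [None] when the midpoint is kept.  A kept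
   midpoint, which is child 0 of its neighbour, loses two neighbours and gets both
   replacements from that side. *)
Definition leg (t : bool) (x : seq F5) (m : option (seq (F5 * F5))) :
    seq (hvertex * seq (F5 * F5)) :=
  [:: (zeros t x 0, M0);
      (zeros t x 1, if m is Some _ then M0
                    else [:: (F0, F1); (F0, F4); (F2, F3)]);
      (zeros t x 3, M1); (zeros t x 4, M1)]
  ++ (if m is Some l then [:: (zeros t x 2, l)] else [::]).

Definition stars : seq (hvertex * seq (F5 * F5)) := flatten
  [:: leg true [::] (Some M0); leg false [:: F0] (Some M1);
      leg false [:: F1] (Some M2); leg false [:: F2] None;
      leg false [:: F3] None; leg false [:: F4] None].

(* The opposite points are (oo) and (0,0,0,0,0). *)
Definition removed : seq hvertex :=
  [:: zeros false [::] 0; zeros true [::] 5] ++ map fst stars.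

Definition new_edges : seq (hvertex * hvertex) :=
  flatten [seq [seq (child p.1 ij.1, child p.1 ij.2) | ij <- p.2] | p <- stars].

Definition patched (v : hvertex) : seq hvertex :=
  [seq w <- hnbrs v | w \notin removed]
  ++ [seq e.2 | e <- new_edges & e.1 == v]
  ++ [seq e.1 | e <- new_edges & e.2 == v].

Definition patch : trie (seq hvertex) :=
  foldr (fun v => insert (patched v) (key v)) Leaf
    (map fst new_edges ++ map snd new_edges).

Definition nbrs (v : hvertex) : seq hvertex :=
  if lookup patch (key v) is Some s then s else hnbrs v.

Definition verts : seq hvertex := [seq v <- hexagon | v \notin removed].

Definition cover : seq hvertex := map fst new_edges.

Definition vertex_ok (v : hvertex) : bool :=
  let s := nbrs v in
  [&& size s == 6, uniq s & all (fun w => [&& size w.2 <= 5, w \notin removed,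
    v != w, v \in nbrs w & [|| w \in hnbrs v, v \in cover | w \in cover]]) s].

Lemma verts_check : all vertex_ok verts.
Proof. by vm_cast_no_check (erefl true). Qed.

Lemma cover_check : all (tree_ball nbrs) (undup cover).
Proof. by vm_cast_no_check (erefl true). Qed.

Lemma size_verts : size verts <= 7783.
Proof. by vm_cast_no_check (erefl true). Qed.

Lemma uniq_verts : uniq verts.
Proof.
suff /distinct_uniq /andP [] : distinct Leaf verts by [].
by vm_cast_no_check (erefl true).
Qed.

Lemma mem_verts v : (v \in verts) = ((v \notin removed) && (v \in hexagon)).
Proof. exact: mem_filter. Qed.

Opaque verts removed cover.

Lemma verts_hexagon v : v \in verts -> v \in hexagon.
Proof.
move=> vv; have /andP [_ hv] : (v \notin removed) && (v \in hexagon).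
  by rewrite -mem_verts.
exact hv.
Qed.

Lemma nbrsP v w : v \in verts -> w \in nbrs v ->
  [/\ w \in verts, v != w, v \in nbrs w
    & w \notin cover -> v \notin cover -> w \in hnbrs v].
Proof.
move=> /(allP verts_check) /and3P [_ _ /allP ok] /ok /and5P [sz new -> -> edge].
split=> // [|wc vc]; first by rewrite mem_verts new mem_hexagon.
by move: edge; rewrite (negPf wc) (negPf vc) !orbF.
Qed.

Lemma nbrs_sym : {in verts &, symmetric (fun v w => w \in nbrs v)}.
Proof. by move=> v w hv hw; apply/idP/idP => /nbrsP []. Qed.

Lemma nbrs_girth (c : seq hvertex) : all (mem verts) c ->
  ucycle (fun v w => w \in nbrs v) c -> 2 < size c -> 10 < size c.
Proof.
move=> hc /andP [cc uc] gt2.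
have [/hasP [r rc]|no_cover] := boolP (has (mem cover) c).
  rewrite /= -mem_undup => /(allP cover_check) /distinct_uniq /andP [ub _].
  apply: (ucycle_ball ub _ _ rc gt2); last by rewrite /ucycle cc.
  by move=> v w vc wc; apply: nbrs_sym; apply: (allP hc).
have hn : all [predD verts & cover] c.
  apply/allP => v vc; apply/andP; split; last exact: (allP hc).
  by apply: contraNN no_cover => ?; apply/hasP; exists v.
have hexc : cycle (fun v w => w \in hnbrs v) c.
  apply: sub_in_cycle hn cc => v w /andP [vn vv] /andP [wn _] /nbrsP.
  by case=> // _ _ _; apply.
have vc : head (true, [::]) c \in c by case: (c) gt2 => //= *; apply: mem_head.
have vh := verts_hexagon (allP hc _ vc).
apply: (hexagon_no_short_cycle vh) vc gt2; last by rewrite /ucycle hexc.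
by apply: sub_all hc => v; apply: verts_hexagon.
Qed.

(** * The excised graph *)

Definition excised_adj : rel (seq_sub verts) := fun x y => val y \in nbrs (val x).

Lemma excised_adj_sym : symmetric excised_adj.
Proof. by move=> x y; apply: nbrs_sym; apply: valP. Qed.

Lemma excised_adj_irrefl : irreflexive excised_adj.
Proof. by move=> x; apply/negP => /(nbrsP (valP x)) []; rewrite eqxx. Qed.

Definition excised : sgraph := SGraph excised_adj_sym excised_adj_irrefl.

Lemma excised_order : graph_order excised <= 7783.
Proof. by rewrite /graph_order card_seq_sub ?uniq_verts ?size_verts. Qed.

Lemma excised_regular : regular 6 excised.
Proof.
move=> x; have /and3P [/eqP <- un _] := allP verts_check _ (valP x).
rewrite cardE -(size_map val); apply/perm_size/uniq_perm => //.
  by rewrite map_inj_uniq ?enum_uniq //; apply: val_inj.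
move=> w; apply/mapP/idP => [[y + ->]|wx]; first by rewrite mem_enum inE.
have [wv _ _ _] := nbrsP (valP x) wx.
by exists (SeqSub wv); rewrite // mem_enum inE.
Qed.

Lemma excised_ucycle (c : seq excised) :
  ucycle (@adj excised) c = ucycle (fun v w => w \in nbrs v) (map val c).
Proof. by rewrite /ucycle cycle_map map_inj_uniq //; apply: val_inj. Qed.

(** A 12-cycle of the hexagon through the removed line [oo], whose corner there is cut off by the
    new edge between children [F4] and [F1]. *)
Definition short_cycle : seq hvertex :=
  [:: zeros true [:: F1] 0; zeros true [:: F1] 1; zeros true [:: F1] 2;
      (true, [:: F1; F0; F0; F1]); (true, [:: F1; F0; F0; F1; F0]);
      (false, [:: F0; F0; F1; F0; F0]); (true, [:: F4; F0; F0; F1; F0]);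
      (true, [:: F4; F0; F0; F1]); zeros true [:: F4] 2; zeros true [:: F4] 1;
      zeros true [:: F4] 0].

Lemma short_cycle_check : all (mem verts) short_cycle &&
  ucycleb (fun v w => w \in nbrs v) short_cycle.
Proof. by vm_cast_no_check (erefl true). Qed.

Lemma excised_girth : has_girth excised 11.
Proof.
split=> [|c [ucc gt2]].
  have /andP [hc ucc] := short_cycle_check.
  pose c : seq excised := pmap insub short_cycle.
  have vc : map val c = short_cycle.
    rewrite (pmap_filter (@insubK _ _ _)); apply/all_filterP.
    by apply: sub_all hc => v hv; rewrite insubT.
  exists c; last by rewrite -(size_map val) vc.
  split; first by rewrite excised_ucycle vc; exact ucc.
  by rewrite -(size_map val) vc.
rewrite -(size_map val); apply: nbrs_girth; rewrite ?size_map //.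
  by rewrite all_map; apply/allP => x _; apply: valP.
by rewrite -excised_ucycle.
Qed.

Lemma is_n_exists k g n (G : sgraph) : kg_graph k g G -> graph_order G <= n ->
  exists2 m, is_n k g m & m <= n.
Proof.
have [N] := ubnP (graph_order G).
elim: N G n => // N IHN G n ltGN kgG leGn.
have [[G' [kgG' ltG]]|minG] :=
  classic (exists G', kg_graph k g G' /\ graph_order G' < graph_order G).
  by apply: (IHN G') => //; lia.
exists (graph_order G) => //; split; first by exists G.
move=> G' kgG'; rewrite leqNgt; apply/negP => ltG.
by apply: minG; exists G'.
Qed.

Theorem mainTheorem7 :
  (exists2 m : nat, is_n 6 11 m & m <= 7783) /\
  (exists2 G : sgraph, kg_graph 6 11 G & graph_order G <= 7783).
Proof.
have kg : kg_graph 6 11 excised.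
  by split; [exact: excised_regular | exact: excised_girth].
split; last by exists excised => //; apply: excised_order.
exact: is_n_exists kg excised_order.
Qed.
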